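(* Consider a system of $n$ interconnected components with structure function $\phi\colon\{0,1\}^n\to\{0,1\}$, whose component lifetimes $X_1,\ldots,X_n$ are continuous and independent and identically distributed, and let $(s_1,\ldots,s_n)$ be the signature of the system. If the weight function $w$ defining the index $I$ is symmetric, then $s_k=I(\phi,k)$ for every $k\in[n]$.
   Context: Let $n\geqslant 1$ and $[n]=\{1,\ldots,n\}$. The structure function $\phi\colon\{0,1\}^n\to\{0,1\}$ of a system gives the state of the system ($1$ = functioning, $0$ = failed) as a function of the states of its components; it is nondecreasing in each variable, with $\phi(0,\ldots,0)=0$ and $\phi(1,\ldots,1)=1$. Component $i$ is functioning at time $t$ exactly when $X_i>t$, and the system lifetime is $T=\sup\{t:\phi(\mathbf{x}(t))=1\}$, where $x_i(t)=1$ if $X_i>t$ and $x_i(t)=0$ otherwise. ''Continuous'' means that the common distribution function of the lifetimes is continuous. Let $X_{(1)}\leqslant\cdots\leqslant X_{(n)}$ be the order statistics of $X_1,\ldots,X_n$. The signature of the system is the $n$-tuple $(s_1,\ldots,s_n)$ with $s_k=\Pr(T=X_{(k)})$. Let $w\colon\{0,1\}^n\to\left]0,\infty\right[$ be a weight function, normalized so that $\sum_{\mathbf{x}}w(\mathbf{x})=1$; it is symmetric if it is invariant under all permutations of its variables. With $|\mathbf{x}|=\sum_i x_i$, for $f\colon\{0,1\}^n\to\mathbb{R}$ and $s\in\{0,1,\ldots,n\}$ define $\overline{f}(s)=\dfrac{\sum_{|\mathbf{x}|=s}w(\mathbf{x})f(\mathbf{x})}{\sum_{|\mathbf{x}|=s}w(\mathbf{x})}$.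 The influence index is $I(f,k)=\overline{f}(n-k+1)-\overline{f}(n-k)$ for $k\in[n]$. *)

(* Defs.v *)
From mathcomp Require Import all_boot all_order all_fingroup all_algebra.
From mathcomp Require Import all_classical all_reals all_analysis.

Set Implicit Arguments.
Unset Strict Implicit.
Unset Printing Implicit Defensive.

Import Order.TTheory GRing.Theory Num.Theory.
Import numFieldNormedType.Exports.

Local Open Scope classical_set_scope.
Local Open Scope ring_scope.

(* {0,1}^n; components are numbered 0, ..., n-1. *)
Definition cube (n : nat) := {ffun 'I_n -> bool}.

Definition allx (n : nat) (b : bool) : cube n := [ffun=> b].

Definition structure_function (n : nat) (phi : cube n -> bool) : Prop :=
  [/\ forall (i : 'I_n) (x y : cube n),
        (forall j, j != i -> x j = y j) -> x i ==> y i -> phi x ==> phi y,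
      phi (allx n false) = false
    & phi (allx n true) = true].

Definition level (n : nat) (x : cube n) : nat := (\sum_(i < n) x i)%N.

Section Index.
Variables (R : realType) (n : nat).
Implicit Types (w f : cube n -> R).

Definition weight_function w : Prop :=
  (forall x, 0 < w x) /\ \sum_x w x = 1.

Definition symmetric_weight w : Prop :=
  forall (s : 'S_n) (x : cube n), w [ffun i => x (s i)] = w x.

Definition level_mean w f (s : nat) : R :=
  (\sum_(x : cube n | level x == s) w x * f x) /
  (\sum_(x : cube n | level x == s) w x).

(* For 1 <= k <= n, the only range of interest, the subtractions on nat are
   exact. *)
Definition influence w f (k : nat) : R :=
  level_mean w f (n - k + 1) - level_mean w f (n - k).

End Index.

Section System.
Context {d : measure_display} {Omega : measurableType d} {R : realType}.
Variables (P : probability Omega R) (n : nat).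
Implicit Types (X : 'I_n -> {RV P >-> R}) (phi : cube n -> bool).

Definition mutually_independent X : Prop :=
  forall (J : {set 'I_n}) (A : 'I_n -> set R),
    (forall i, measurable (A i)) ->
    P (\bigcap_(i in [set` J]) (X i @^-1` A i)) =
    (\prod_(i in J) P (X i @^-1` A i))%E.

(* Only measurable sets are compared: the values of an (outer-extended)
   measure on other sets carry no probabilistic meaning. *)
Definition identically_distributed X : Prop :=
  forall (i j : 'I_n) (A : set R), measurable A ->
    distribution P (X i) A = distribution P (X j) A.

Definition continuous_lifetimes X : Prop :=
  forall i : 'I_n, continuous (cdf (X i)).

Definition state X (om : Omega) (t : R) : cube n := [ffun i => t < X i om].

(* When phi is a structure function and n > 0 the set below is nonempty and
   bounded above, so that the total function sup is the true supremum. *)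
Definition system_lifetime phi X (om : Omega) : R :=
  sup [set t : R | phi (state X om t)].

(* X_(k), for 1 <= k <= n. *)
Definition order_statistic X (k : nat) (om : Omega) : R :=
  nth 0 (sort <=%R [seq X i om | i <- enum 'I_n]) k.-1.

Definition signature phi X (k : nat) : \bar R :=
  P [set om | system_lifetime phi X om = order_statistic X k om].

End System.

(* Main.v *)
Require Import Defs.
From mathcomp Require Import all_boot all_order all_fingroup all_algebra zify.
From mathcomp Require Import all_classical all_reals all_analysis.
From mathcomp Require Import measurable_realfun.

Set Implicit Arguments.
Unset Strict Implicit.
Unset Printing Implicit Defensive.

Import Order.TTheory GRing.Theory Num.Theory.
Import numFieldNormedType.Exports.

Local Open Scope classical_set_scope.
Local Open Scope ring_scope.

(** Write v for the vector of observed lifetimes and c for its k-th smallest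
    value.  Just before time c the working components are those with v >= c,
    and from time c on those with v > c; as phi is monotone, the system dies
    exactly at time c when phi accepts the first set and rejects the second
    ([lifetimeP]).  So the event T = X_(k) depends only on the order pattern of
    the lifetimes, the finite boolean matrix of the comparisons v i <= v j, and
    the probability space may be replaced by the finite law of that matrix.

    Two facts about this law suffice.  It is invariant under relabelling of the
    components ([pattern_mass_relabel]), because i.i.d. lifetimes are
    exchangeable; and it charges only patterns without ties
    ([pattern_mass_strict]), because a continuous distribution has no atoms.
    Without ties, the components with v > c and those with v >= c are the
    unique upper sets of the pattern having n - k and n - k + 1 elements.  By
    exchangeability each of them is uniformly distributed over the sets of its
    size.  A symmetric weight is constant on the states of a given level, hence
    [level_mean] is a plain average there, namely the expectation of f over a
    uniform upper set ([level_mean_selection]).  Finally phi {v > c} implies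
    phi {v >= c}, so the probability that phi accepts the second set and
    rejects the first is the difference of the two expectations, that is, the
    influence index ([sum_signature_influence]). *)

(** * Lifetime of a system with known component lifetimes *)

(** The definition of a structure function compares states that differ in a
    single component; changing the components of x into those of y one at a
    time extends monotonicity to all comparable states. *)
Lemma structure_mono n (phi : cube n -> bool) (x y : cube n) :
  structure_function phi -> (forall i, x i -> y i) -> phi x -> phi y.
Proof.
move=> [phi_mono _ _] xy phix.
pose z m : cube n := [ffun i : 'I_n => if (i < m)%N then y i else x i].
have phiz m : (m <= n)%N -> phi (z m).
  elim: m => [_|m IH mn].
    by rewrite (_ : z 0%N = x)//; apply/ffunP => i; rewrite ffunE.
  have zm j : j != Ordinal mn -> z m j = z m.+1 j.
    move=> jm; rewrite !ffunE [in RHS]ltnS [in RHS]leq_eqVlt.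
    suff -> : (j == m :> nat) = false by [].
    by apply: contraNF jm => /eqP jm; apply/eqP/val_inj.
  have zx : z m (Ordinal mn) ==> z m.+1 (Ordinal mn).
    by rewrite !ffunE ltnn ltnSn; apply/implyP; exact: xy.
  by have /implyP := phi_mono _ _ _ zm zx; apply; exact/IH/ltnW.
by rewrite (_ : y = z n) ?phiz//; apply/ffunP => i; rewrite ffunE ltn_ord.
Qed.

Section Lifetime.
Variables (R : realType) (n : nat) (phi : cube n -> bool) (v : 'I_n -> R).
Hypothesis hphi : structure_function phi.

Let alive (t : R) : cube n := [ffun i => t < v i].

Let alive_anti s t : s <= t -> phi (alive t) -> phi (alive s).
Proof.
by move=> st; apply: structure_mono => // i; rewrite !ffunE; exact: le_lt_trans.
Qed.

Let alive_has_sup : has_sup [set t | phi (alive t)].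
Proof.
have [_ phi0 phi1] := hphi; split.
- have /filter_ex [t tv] : \forall t \near ninfty_nbhs R, forall i, t < v i.
    by apply: filter_forall => i; exact: nbhs_ninfty_lt (num_real _).
  exists t => /=; suff -> : alive t = allx n true by [].
  by apply/ffunP => i; rewrite !ffunE tv.
- have /filter_ex [M Mv] : \forall M \near pinfty_nbhs R, forall i, v i < M.
    by apply: filter_forall => i; exact: nbhs_pinfty_gt (num_real _).
  exists M => t /=; rewrite leNgt; apply: contraPN => Mt.
  suff -> : alive t = allx n false by rewrite phi0.
  apply/ffunP => i; rewrite !ffunE; apply/negbTE.
  by rewrite -leNgt ltW// (lt_trans (Mv i)).
Qed.

(** The state is right-continuous in time, and its left limit at c is the set
    of components with v >= c; both because there are finitely many
    components. *)
Let alive_right c : exists2 t, c < t & alive t = alive c.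
Proof.
have tv_near : \forall t \near c^'+, forall i, (t < v i) = (c < v i).
  apply: filter_forall => i; have [cv|vc] := ltP c (v i).
    exact: nbhs_right_lt.
  apply: filterS (nbhs_right_gt c) => t ct.
  by apply/negbTE; rewrite -leNgt (le_trans vc)// ltW.
have [t [ct tv]] := filter_ex (filterI (nbhs_right_gt c) tv_near).
by exists t => //; apply/ffunP => i; rewrite !ffunE tv.
Qed.

Let alive_left c : exists2 t, t < c & alive t = [ffun i => c <= v i].
Proof.
have tv_near : \forall t \near c^'-, forall i, (t < v i) = (c <= v i).
  apply: filter_forall => i; have [cv|vc] := leP c (v i).
    by apply: filterS (nbhs_left_lt c) => t tc; exact: lt_le_trans cv.
  apply: filterS (nbhs_left_gt vc) => t vt.
  by apply/negbTE; rewrite -leNgt ltW.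
have [t [ct tv]] := filter_ex (filterI (nbhs_left_lt c) tv_near).
by exists t => //; apply/ffunP => i; rewrite !ffunE tv.
Qed.

(** Ties are allowed here: right-continuity of the state makes phi {c < v}
    incompatible with death at time c, and the left limit does the same for
    the failure of phi {c <= v}. *)
Lemma lifetimeP c : sup [set t | phi (alive t)] = c <->
  phi [ffun i => c <= v i] && ~~ phi [ffun i => c < v i].
Proof.
have [Sn0 Sub] := alive_has_sup; split => [supc|/andP[phige phigt]].
- apply/andP; split.
  + have [t tc <-] := alive_left c; apply/negPn/negP => phit.
    suff : c <= t by rewrite leNgt tc.
    rewrite -supc; apply: ge_sup => // s /= phis.
    by rewrite leNgt; apply: contra phit => ts; exact: alive_anti (ltW ts) phis.
  + have [t ct phit] := alive_right c; apply/negP => phic.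
    suff : t <= c by rewrite leNgt ct.
    by rewrite -supc; apply: ub_le_sup => //=; rewrite phit.
- apply/eqP; rewrite eq_le; apply/andP; split.
  + apply: ge_sup => // t /= phit; rewrite leNgt; apply: contra phigt => ct.
    exact: alive_anti (ltW ct) phit.
  + rewrite leNgt; apply/negP => supc; have [supt tc] := midf_lt supc.
    move: supt; rewrite ltNge; apply/negP/negPn; apply: ub_le_sup => //=.
    apply: structure_mono phige => // i; rewrite !ffunE.
    exact: lt_le_trans.
Qed.

End Lifetime.

(** * Order patterns *)

Definition order_pattern (n : nat) := {ffun 'I_n * 'I_n -> bool}.

Section OrderPattern.
Variables (R : realType) (n : nat).
Implicit Types (m : order_pattern n) (x y : cube n) (v : 'I_n -> R).

Definition pattern v : order_pattern n := [ffun q => v q.1 <= v q.2].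

(** The component that realises the k-th order statistic, computed from the
    pattern alone; [i0] is the default value of [nth], reached only for k out
    of range. *)
Definition kth (i0 : 'I_n) k m : 'I_n :=
  nth i0 (sort (fun i j => m (i, j)) (enum 'I_n)) k.-1.

(** For the pattern of v, [surviving_at] is the set of components with value
    at least v i, those working just before time v i, and [surviving_after] is
    the set of those working at time v i. *)
Definition surviving_at m (i : 'I_n) : cube n := [ffun j => m (i, j)].

Definition surviving_after m (i : 'I_n) : cube n := [ffun j => ~~ m (j, i)].

(** Every component of x outlives every component outside x. *)
Definition upper m x : bool :=
  [forall i, forall j, (x i && ~~ x j) ==> ~~ m (i, j)].

Lemma upperP v x : reflect (forall i j, x i -> ~~ x j -> v j < v i)
  (upper (pattern v) x).
Proof.
apply: (iffP forallP) => [vx i j xi xj|vx i].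
  have /forallP/(_ j) := vx i.
  by rewrite xi xj ffunE /= -ltNge.
apply/forallP => j; apply/implyP => /andP[xi xj].
by rewrite ffunE -ltNge; exact: vx.
Qed.

Lemma surviving_atE v i : surviving_at (pattern v) i = [ffun j => v i <= v j].
Proof. by apply/ffunP => j; rewrite !ffunE. Qed.

Lemma surviving_afterE v i :
  surviving_after (pattern v) i = [ffun j => v i < v j].
Proof. by apply/ffunP => j; rewrite !ffunE -ltNge. Qed.

Lemma upper_surviving_at v i : upper (pattern v) (surviving_at (pattern v) i).
Proof.
rewrite surviving_atE; apply/upperP => j l; rewrite !ffunE -ltNge => ij li.
exact: lt_le_trans ij.
Qed.

Lemma upper_surviving_after v i :
  upper (pattern v) (surviving_after (pattern v) i).
Proof.
rewrite surviving_afterE; apply/upperP => j l; rewrite !ffunE -leNgt => ij li.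
exact: le_lt_trans ij.
Qed.

Lemma level_count x : level x = count x (enum 'I_n).
Proof.
rewrite -sum1_count [RHS]big_mkcond /level big_enum /=.
by apply: eq_bigr => i _; case: (x i).
Qed.

Lemma levelE x : level x = #|finset x|.
Proof.
rewrite /level cardsE -sum1_card [RHS]big_mkcond; apply: eq_bigr => i _.
by rewrite -[i \in _]/(x i); case: (x i).
Qed.

(** Two distinct upper sets of equal size would each contain a component
    missing from the other, and each of these would outlive the other. *)
Lemma upper_inj v x y : upper (pattern v) x -> upper (pattern v) y ->
  level x = level y -> x = y.
Proof.
move=> /upperP vx /upperP vy lxy.
have [xy|] := boolP (finset x \subset finset y).
  have /eqP/setP xyE : finset x == finset y.
    by rewrite eqEcard xy -!levelE lxy leqnn.
  by apply/ffunP => i; have := xyE i; rewrite !inE.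
move=> /subsetPn[i]; rewrite !inE => xi yi.
have [yx|] := boolP (finset y \subset finset x).
  have /eqP/setP/(_ i) : finset y == finset x.
    by rewrite eqEcard yx -!levelE lxy leqnn.
  by rewrite !inE xi (negbTE yi).
move=> /subsetPn[j]; rewrite !inE => yj xj.
by have := lt_trans (vx i j xi xj) (vy j i yj yi); rewrite ltxx.
Qed.

Section Kth.
Variables (i0 : 'I_n) (k : nat) (v : 'I_n -> R).
Hypothesis hk : (1 <= k <= n)%N.

Let values := sort <=%R [seq v i | i <- enum 'I_n].

Let size_values : size values = n.
Proof. by rewrite size_sort size_map size_enum_ord. Qed.

Let k_lt : (k.-1 < n)%N.
Proof. by case/andP: hk => k0; rewrite prednK. Qed.

(** Sorting the components by their values and sorting the values themselves
    give the same k-th entry. *)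
Lemma kthE : v (kth i0 k (pattern v)) = nth 0 values k.-1.
Proof.
rewrite /values sort_map (nth_map i0) ?size_sort ?size_enum_ord//.
rewrite /kth; congr (v (nth _ (sort _ _) _)).
by apply/funext => i; apply/funext => j; rewrite ffunE.
Qed.

Hypothesis v_inj : injective v.

Let values_sorted : sorted <%R values.
Proof.
by rewrite sort_lt_sorted map_inj_uniq ?enum_uniq.
Qed.

Let count_values (a : pred R) : count a values = level [ffun i => a (v i)].
Proof.
rewrite (seq.permP (permEl (perm_sort _ _))) count_map level_count.
by apply: eq_count => i; rewrite /= ffunE.
Qed.

Lemma level_surviving_after :
  level (surviving_after (pattern v) (kth i0 k (pattern v))) = (n - k)%N.
Proof.
rewrite surviving_afterE kthE -count_values.
have := count_predC (<= nth 0 values k.-1) values.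
rewrite count_le_nth ?size_values// prednK; last by case/andP: hk.
move=> nE; rewrite -[X in (X - _)%N]nE addKn; apply: eq_count => r.
by rewrite /= ltNge.
Qed.

Lemma level_surviving_at :
  level (surviving_at (pattern v) (kth i0 k (pattern v))) = (n - k + 1)%N.
Proof.
rewrite surviving_atE kthE -count_values.
have := count_predC (< nth 0 values k.-1) values.
rewrite count_lt_nth ?size_values// => nE.
have -> : (n - k + 1 = n - k.-1)%N by lia.
rewrite -[X in (X - _)%N]nE addKn; apply: eq_count => r.
by rewrite /= leNgt.
Qed.

End Kth.

End OrderPattern.

Lemma count_bool (a : pred bool) (s : seq bool) :
  count a s = (a true * count id s + a false * (size s - count id s))%N.
Proof.
rewrite -(count_predC id s) addKn; elim: s => [|b s /= ->].
  by rewrite !muln0.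
by case: b; case: (a true); case: (a false); rewrite /= ?mul0n ?mul1n; lia.
Qed.

(** The symmetric group acts transitively on the states of a given level: two
    boolean tuples with the same number of ones are rearrangements of each
    other. *)
Lemma level_perm n (x y : cube n) : level x = level y ->
  exists s : 'S_n, y = [ffun i => x (s i)].
Proof.
have count_id (z : cube n) : count id [tuple z i | i < n] = level z.
  by rewrite count_map level_count.
move=> lxy.
have : perm_eq [tuple y i | i < n] [tuple x i | i < n].
  apply/seq.permP => a; rewrite count_bool [RHS]count_bool.
  by rewrite !count_id !size_tuple lxy.
move=> /tuple_permP[s E]; exists s; apply/ffunP => i; rewrite ffunE.
have /(congr1 (fun t => nth false t i)) := E.
by rewrite -!tnth_nth !tnth_mktuple.
Qed.

(** * Exchangeable random order patterns *)

Definition relabel n (s : 'S_n) (m : order_pattern n) : order_pattern n :=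
  [ffun q => m (s q.1, s q.2)].

Lemma pattern_relabel (R : realType) n (s : 'S_n) (v : 'I_n -> R) :
  pattern (v \o s) = relabel s (pattern v).
Proof. by apply/ffunP => q; rewrite !ffunE. Qed.

Lemma relabelK n (s : 'S_n) : cancel (relabel s) (relabel s^-1).
Proof.
by move=> m; apply/ffunP => -[i j]; rewrite !ffunE /= !permKV.
Qed.

Lemma upper_relabel n (s : 'S_n) m (x : cube n) :
  upper (relabel s m) [ffun i => x (s i)] = upper m x.
Proof.
apply/forallP/forallP => mx i; apply/forallP => j.
  have /forallP/(_ (s^-1 j)%g) := mx (s^-1 i)%g.
  by rewrite !ffunE /= !permKV.
have /forallP/(_ (s j)) := mx (s i).
by rewrite !ffunE.
Qed.

Section ExchangeablePattern.
Variables (R : realType) (n : nat) (p : order_pattern n -> R).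
Hypothesis p_total : \sum_m p m = 1.
Hypothesis p_strict : forall m, p m != 0 ->
  exists2 v : 'I_n -> R, injective v & m = pattern v.
Hypothesis p_exch : forall s m, p (relabel s m) = p m.

Definition upper_mass (x : cube n) : R := \sum_(m | upper m x) p m.

(** All states of a level carry the same mass, since a permutation that maps
    one to the other relabels the patterns without changing their law. *)
Lemma upper_mass_level x y : level x = level y -> upper_mass x = upper_mass y.
Proof.
move=> /level_perm[s ->]; rewrite /upper_mass.
rewrite [RHS](reindex_inj (can_inj (relabelK s))).
by apply: eq_big => m; [rewrite upper_relabel|rewrite p_exch].
Qed.

(** A rule [Y] that extracts from each strict pattern an upper set of fixed
    size b; by uniqueness it picks the only one. *)
Section Selection.
Variables (b : nat) (Y : order_pattern n -> cube n).
Hypothesis level_Y : forall v : 'I_n -> R, injective v ->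
  level (Y (pattern v)) = b.
Hypothesis upper_Y : forall v : 'I_n -> R, upper (pattern v) (Y (pattern v)).

(** The left side is the expectation of f at the state picked by [Y], grouped
    on the right according to the value of that state. *)
Lemma sum_selection (f : cube n -> R) :
  \sum_m p m * f (Y m) = \sum_(x | level x == b) upper_mass x * f x.
Proof.
under [RHS]eq_bigr do rewrite mulr_suml.
rewrite (exchange_big_dep xpredT)//=; apply: eq_bigr => m _.
have [pm0|/p_strict[v v_inj mE]] := eqVneq (p m) 0.
  by rewrite pm0 mul0r big1// => x _; rewrite mul0r.
rewrite (big_pred1 (Y m))// => x /=; rewrite mE.
apply/andP/eqP => [[/eqP xb vx]|->]; last by rewrite level_Y.
by apply: (upper_inj vx); rewrite ?level_Y.
Qed.

(** Both [w] and [upper_mass] are constant on level b, so that either of them,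
    normalised, averages f uniformly over this level. *)
Lemma level_mean_selection (w f : cube n -> R) :
  weight_function w -> symmetric_weight w ->
  level_mean w f b = \sum_m p m * f (Y m).
Proof.
move=> [w_gt0 _] w_sym.
have w_level x y : level x = level y -> w x = w y.
  by move=> /level_perm[s ->]; rewrite w_sym.
have mass1 : \sum_(x | level x == b) upper_mass x = 1.
  have := sum_selection (fun=> 1).
  under eq_bigr do rewrite mulr1.
  by under [RHS]eq_bigr do rewrite mulr1; rewrite p_total.
have [x0 x0b] : exists x : cube n, level x == b.
  apply/existsP; apply: contraT => /existsPn nob.
  move: mass1; rewrite big_pred0 => [/eqP|x]; last exact/negbTE.
  by rewrite eq_sym oner_eq0.
have const (g h : cube n -> R) : (forall x y, level x = level y -> g x = g y) ->
    \sum_(x | level x == b) g x * h x =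
    g x0 * \sum_(x | level x == b) h x.
  move=> glev; rewrite mulr_sumr; apply: eq_bigr => x /eqP xb.
  by rewrite (glev x x0) // xb (eqP x0b).
have sum1 (g : cube n -> R) : \sum_(x | level x == b) g x =
    \sum_(x | level x == b) g x * 1.
  by under [RHS]eq_bigr do rewrite mulr1.
rewrite sum_selection /level_mean (const _ f w_level).
rewrite (sum1 w) (const _ (fun=> 1) w_level).
rewrite (const _ f upper_mass_level).
move: mass1; rewrite sum1 (const _ (fun=> 1) upper_mass_level) => mass1.
have w0 : w x0 != 0 by rewrite gt_eqF.
set N := \sum_(x | level x == b) 1 in mass1 *.
have N0 : N != 0.
  by apply: contra_eq_neq mass1 => ->; rewrite mulr0 eq_sym oner_eq0.
rewrite -mulf_div divff// mul1r mulrC; congr (_ * _).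
by rewrite -[LHS]mul1r -mass1 mulfK.
Qed.

End Selection.

Lemma sum_signature_influence (phi : cube n -> bool) (w : cube n -> R)
  (i0 : 'I_n) (k : nat) : structure_function phi ->
  weight_function w -> symmetric_weight w -> (1 <= k <= n)%N ->
  \sum_(m | phi (surviving_at m (kth i0 k m)) &&
            ~~ phi (surviving_after m (kth i0 k m))) p m =
  influence w (fun x => (phi x)%:R) k.
Proof.
move=> hphi hw hsym hk; rewrite /influence.
rewrite (level_mean_selection (Y := fun m => surviving_at m (kth i0 k m)))//;
  last 2 first.
- by move=> v v_inj; exact: level_surviving_at.
- by move=> v; exact: upper_surviving_at.
rewrite (level_mean_selection (Y := fun m => surviving_after m (kth i0 k m)))//;
  last 2 first.
- by move=> v v_inj; exact: level_surviving_after.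
- by move=> v; exact: upper_surviving_after.
rewrite -sumrB big_mkcond; apply: eq_bigr => m _ /=; rewrite -mulrBr.
have [->|/p_strict[v v_inj ->]] := eqVneq (p m) 0.
  by rewrite mul0r if_same.
set x := surviving_at _ _; set y := surviving_after _ _.
(* As y is contained in x, the indicator of phi x and not phi y is the
   difference of the indicators of phi x and phi y. *)
have : phi y -> phi x.
  apply: structure_mono hphi _ => i.
  by rewrite /x /y surviving_atE surviving_afterE !ffunE; exact: ltW.
by case: (phi x) (phi y) => -[] //=;
  rewrite ?subr0 ?mulr1 ?subrr ?mulr0// => /(_ isT).
Qed.

End ExchangeablePattern.

(** * The order pattern of the lifetimes is measurable and exchangeable *)

Section MeasurablePattern.
Context {d : measure_display} {T : measurableType d} {R : realType} {n : nat}.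
Variable Y : 'I_n -> T -> R.
Hypothesis mY : forall i, measurable_fun setT (Y i).

Lemma measurable_pattern m : measurable [set t | pattern (Y ^~ t) = m].
Proof.
rewrite (_ : [set _ | _] =
    \bigcap_(q in [set: 'I_n * 'I_n]) [set t | (Y q.1 t <= Y q.2 t) = m q]).
  apply: fin_bigcap_measurable => // q _.
  rewrite -[X in measurable X]setTI.
  exact: (measurable_fun_ler (mY q.1) (mY q.2) measurableT
    (I : measurable [set m q])).
apply/seteqP; split=> [t <- q _ /=|t tm]; first by rewrite ffunE.
by apply/ffunP => q; rewrite ffunE; exact: tm.
Qed.

End MeasurablePattern.

Section RandomPattern.
Context {d : measure_display} {Omega : measurableType d} {R : realType}.
Variables (P : probability Omega R) (n : nat) (X : 'I_n -> {RV P >-> R}).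

Let pat (om : Omega) : order_pattern n := pattern (fun i => X i om).

Definition pattern_mass (m : order_pattern n) : R :=
  fine (P [set om | pat om = m]).

Lemma pattern_massE m : P [set om | pat om = m] = (pattern_mass m)%:E.
Proof.
rewrite fineK// fin_num_measure//.
by apply: (@measurable_pattern _ _ _ _ (fun i => X i)) => i.
Qed.

(** Reduces the probability of any event that depends only on the pattern to a
    finite sum. *)
Lemma prob_pattern (Q : pred (order_pattern n)) :
  P [set om | Q (pat om)] = (\sum_(m | Q m) pattern_mass m)%:E.
Proof.
rewrite -sumEFin; under eq_bigr do rewrite -pattern_massE.
rewrite (_ : [set _ | _] =
   \bigcup_(m in [set` Q]) [set om | pat om = m]); last first.
  apply/seteqP; split=> [om Qom|om [m /= Qm ->]//]; by exists (pat om).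
rewrite measure_fin_bigcup//.
- by apply/esym/bigfs => [|m _]; rewrite ?index_enum_uniq ?mem_index_enum.
- by move=> m m' _ _ [om [/= <- <-]].
- by move=> m _; apply: (@measurable_pattern _ _ _ _ (fun i => X i)).
Qed.

Lemma pattern_mass_total : \sum_m pattern_mass m = 1.
Proof.
apply/EFin_inj; rewrite -(prob_pattern xpredT) -(probability_setT P).
by congr (P _); apply/seteqP; split.
Qed.

End RandomPattern.

Section Exchangeable.
Context {d : measure_display} {Omega : measurableType d} {R : realType}.
Variables (P : probability Omega R) (n : nat) (X : 'I_n -> {RV P >-> R}).
Hypothesis hindep : mutually_independent X.
Hypothesis hid : identically_distributed X.

(** The boxes are stable under intersection and generate the product
    sigma-algebra on vectors of lifetimes; independence and identical
    distribution determine the law of a vector on boxes. *)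
Let box : set (set ('I_n -> R)) :=
  [set B | exists2 A : 'I_n -> set R, (forall i, measurable (A i)) &
    B = [set v | forall i, A i (v i)]].

Let V := g_sigma_algebraType box.

Let mcoord i : measurable_fun setT ((fun v => v i) : V -> R).
Proof.
move=> _ B mB; rewrite setTI; apply: sub_sigma_algebra.
exists (fun j => if j == i then B else setT).
  by move=> j; case: ifP.
apply/seteqP; split=> [v vB j|v /(_ i)]; last by rewrite eqxx.
by case: eqP => [->|].
Qed.

Let vec (s : 'S_n) (om : Omega) : V := fun i => X (s i) om.

Let mvec s : measurable_fun setT (vec s).
Proof.
apply: (@measurability _ _ Omega V setT (vec s) box) => // _ [_ [A mA ->] <-].
rewrite setTI (_ : _ @^-1` _ = \bigcap_(i in [set: 'I_n]) (X (s i) @^-1` A i)).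
  apply: fin_bigcap_measurable => // i _.
  by rewrite -[X in measurable X]setTI; exact: measurable_funPT.
by apply/seteqP; split=> [om omA i _|om omA i]; exact: omA.
Qed.

Let law_box s A : (forall i, measurable (A i)) ->
  P (vec s @^-1` [set v | forall i, A i (v i)]) =
  (\prod_i distribution P (X i) (A i))%E.
Proof.
move=> mA.
have -> : vec s @^-1` [set v | forall i, A i (v i)] =
    \bigcap_(i in [set` [set: 'I_n]%SET]) (X i @^-1` A (s^-1 i)%g).
  apply/seteqP; split=> [om omA i _|om omA i].
    by have := omA (s^-1 i)%g; rewrite /vec permKV.
  by have := omA (s i); rewrite /= inE permK; apply.
rewrite hindep//; under eq_bigl do rewrite inE.
rewrite (reindex_inj (@perm_inj _ s))/=; apply: eq_bigr => i _.
by rewrite permK; exact: hid.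
Qed.

(** The laws of the vector and of its permutation agree on boxes, by
    [law_box], hence everywhere by the uniqueness theorem for finite measures
    on a pi-system. *)
Lemma exchangeable s (B : set V) : measurable B ->
  P (vec s @^-1` B) = P (vec 1 @^-1` B).
Proof.
move=> mB.
pose f t : {mfun Omega >-> V} := mfun_Sub (mem_set (mvec t)).
rewrite -[LHS]/(distribution P (f s) B) -[RHS]/(distribution P (f 1%g) B).
apply: (@measure_unique _ R V box (fun=> setT)) => //.
- move=> _ _ [A mA ->] [A' mA' ->]; exists (fun i => A i `&` A' i).
    by move=> i; exact: measurableI.
  apply/seteqP; split=> [v [vA vA'] i//|v vAA'].
  by split=> i; have [] := vAA' i.
- by move=> _; exists (fun=> setT) => //; apply/seteqP; split.
- by rewrite bigcup_const//; exists 0%N.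
- by move=> _ [A mA ->]; exact: etrans (law_box s mA) (esym (law_box 1 mA)).
- by move=> _; rewrite ltey_eq fin_num_measure.
Qed.

Lemma pattern_mass_relabel s m :
  pattern_mass X (relabel s m) = pattern_mass X m.
Proof.
rewrite /pattern_mass; congr fine.
pose B m' : set V := [set v | pattern v = m'].
have mB m' : measurable (B m') by exact: measurable_pattern.
have vec1 om : vec 1 om = (fun i => X i om).
  by apply/funext => i; rewrite /vec perm1.
have -> : [set om | pattern (fun i => X i om) = relabel s m] =
    vec 1 @^-1` B (relabel s m).
  by apply/seteqP; split=> om; rewrite /B /= vec1.
rewrite -(exchangeable s)//; congr (P _).
apply/seteqP; split=> om; rewrite /B /=.
  by rewrite (pattern_relabel s (fun i => X i om)) => /(can_inj (relabelK s)).
by rewrite (pattern_relabel s (fun i => X i om)) => ->.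
Qed.

End Exchangeable.

(** * Ties are negligible *)

Section NoTies.
Context {d : measure_display} {Omega : measurableType d} {R : realType}.
Variables (P : probability Omega R).
Local Open Scope ereal_scope.

(** An atom at r would be a jump of the distribution function: its mass is at
    most F (r) - F (r - 1 / (k + 1)) for all k. *)
Lemma continuous_cdf_atomless (Z : {RV P >-> R}) (r : R) :
  continuous (cdf Z) -> distribution P Z [set r] = 0.
Proof.
move=> contZ.
have cvgZ : cdf Z (r - k.+1%:R^-1)%R @[k --> \oo] --> cdf Z r.
  have rk : (r - harmonic k)%R @[k --> \oo] --> (r - 0)%R.
    by apply: cvgB; [exact: cvg_cst|exact: cvg_harmonic].
  rewrite subr0 in rk.
  exact: cvg_comp rk (contZ r).
have le1 k : distribution P Z [set r] + cdf Z (r - k.+1%:R^-1)%R <= cdf Z r.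
  rewrite -measureU//; last first.
    apply/seteqP; split=> // z [/= -> ]; rewrite in_itv/= leNgt.
    by rewrite ltrBlDr ltrDl invr_gt0 ltr0n.
  apply: le_measure; rewrite ?inE//; first exact: measurableU.
  move=> z [/= ->|/=]; rewrite !in_itv//=.
  by move=> /le_trans; apply; rewrite lerBlDr lerDl invr_ge0 ler0n.
have fr : cdf Z r \is a fin_num by rewrite fin_num_measure.
have atomr : distribution P Z [set r] \is a fin_num by rewrite fin_num_measure.
have : distribution P Z [set r] + cdf Z r <= cdf Z r.
  apply: (@cvge_le _ \oo _ _
    (fun k => distribution P Z [set r] + cdf Z (r - k.+1%:R^-1)%R)).
    by near=> k; exact: le1.
  by apply: cvgeD cvgZ; [rewrite fin_num_adde_defr|exact: cvg_cst].
rewrite -{2}[cdf Z r]add0e leeD2rE// => atom0.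
by apply/eqP; rewrite eq_le atom0 measure_ge0.
Unshelve. all: by end_near. Qed.

(** The joint law of an independent pair is the product of its marginals, and
    by Fubini the diagonal is null when the second marginal has no atom. *)
Lemma null_tie (Z1 Z2 : {RV P >-> R}) :
  (forall A B : set R, measurable A -> measurable B ->
    P (Z1 @^-1` A `&` Z2 @^-1` B) = P (Z1 @^-1` A) * P (Z2 @^-1` B)) ->
  continuous (cdf Z2) -> P.-negligible [set om | Z1 om = Z2 om].
Proof.
move=> ind contZ2.
have mZ : measurable_fun setT (fun om => (Z1 om, Z2 om)).
  exact: measurable_fun_pair.
pose Z : {mfun Omega >-> (R * R)%type} := mfun_Sub (mem_set mZ).
have mD : measurable [set z : R * R | z.1 = z.2].
  rewrite (_ : [set z : R * R | _] =
      setT `&` (fun z : R * R => z.1 == z.2) @^-1` [set true]).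
    exact: (measurable_fun_eqr (@measurable_fst _ _ _ _)
      (@measurable_snd _ _ _ _) measurableT (I : measurable [set true])).
  by rewrite setTI; apply/seteqP; split=> z /= /eqP.
exists (Z @^-1` [set z : R * R | z.1 = z.2]); split => //.
  by rewrite -[X in measurable X]setTI; exact: (measurable_funPT Z).
rewrite -[LHS]/(distribution P Z [set z : R * R | z.1 = z.2]).
rewrite -(product_measure_unique (m1 := distribution P Z1)
  (m2 := distribution P Z2))//.
rewrite /product_measure1; apply: integral0_eq => x _ /=.
rewrite (_ : xsection _ _ = [set x]) ?continuous_cdf_atomless//.
by apply/seteqP; split=> y; rewrite /xsection /= inE /=.
Qed.

End NoTies.
Section StrictPattern.
Context {d : measure_display} {Omega : measurableType d} {R : realType}.
Variables (P : probability Omega R) (n : nat) (X : 'I_n -> {RV P >-> R}).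
Hypothesis hcont : continuous_lifetimes X.
Hypothesis hindep : mutually_independent X.

Lemma independent_pair (i j : 'I_n) (A B : set R) : i != j ->
  measurable A -> measurable B ->
  (P (X i @^-1` A `&` X j @^-1` B) = P (X i @^-1` A) * P (X j @^-1` B))%E.
Proof.
move=> ij mA mB; pose C l := if l == i then A else B.
have := @hindep [set i; j]%SET C.
rewrite big_setU1 ?inE//= big_set1 /C eqxx eq_sym (negbTE ij) => <-.
  congr (P _); apply/seteqP; split=> om.
    move=> [Ai Bj] l /=; rewrite !inE => /orP[]/eqP ->; first by rewrite eqxx.
    by rewrite eq_sym (negbTE ij).
  move=> omC; split.
    by have := omC i; rewrite /= !inE eqxx; exact.
  by have := omC j; rewrite /= !inE eqxx orbT eq_sym (negbTE ij); exact.
by move=> l; case: ifP.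
Qed.

(** If a pattern of positive mass had a tie between i and j, the whole event
    that this pattern occurs would lie in the null event X i = X j. *)
Lemma pattern_mass_strict m : pattern_mass X m != 0 ->
  exists2 v : 'I_n -> R, injective v & m = pattern v.
Proof.
move=> pm.
have [om omE] : [set om | pattern (fun i => X i om) = m] !=set0.
  apply/set0P; apply: contra_neq pm => E.
  by rewrite /pattern_mass E measure0.
exists (fun i => X i om) => // i j Xij; apply/eqP; apply: contraNT pm => ij.
have tie : P.-negligible [set om' | X i om' = X j om'].
  apply: null_tie; last exact: hcont.
  by move=> A B; exact: independent_pair.
have null : P.-negligible [set om' | pattern (fun l => X l om') = m].
  apply: negligibleS tie => om' /= om'E; apply/eqP; rewrite eq_le.
  have /ffunP/(_ (i, j)) := etrans om'E (esym omE).
  have /ffunP/(_ (j, i)) := etrans om'E (esym omE).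
  by rewrite !ffunE /= Xij lexx => -> ->.
rewrite /pattern_mass; move/negligibleP : null => ->//.
by apply: (@measurable_pattern _ _ _ _ (fun i => X i)).
Qed.

End StrictPattern.

(** * Signature and influence index *)

Theorem mainTheorem10 (R : realType) (d : measure_display)
  (Omega : measurableType d) (P : probability Omega R)
  (n : nat) (hn : (1 <= n)%N)
  (phi : cube n -> bool) (hphi : structure_function phi)
  (X : 'I_n -> {RV P >-> R})
  (hcont : continuous_lifetimes X)
  (hindep : mutually_independent X)
  (hid : identically_distributed X)
  (w : cube n -> R) (hw : weight_function w) (hsym : symmetric_weight w)
  (k : nat) (hk : (1 <= k <= n)%N) :
  signature phi X k = (influence w (fun x => (phi x)%:R) k)%:E.
Proof.
pose i0 : 'I_n := Ordinal hn.
rewrite -(@sum_signature_influence _ _ (pattern_mass X) (pattern_mass_total X)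
  (pattern_mass_strict hcont hindep) (pattern_mass_relabel hindep hid)
  phi w i0 k)//.
rewrite -(prob_pattern X (fun m => phi (surviving_at m (kth i0 k m)) &&
  ~~ phi (surviving_after m (kth i0 k m)))).
congr (P _); apply/funext => om; apply/propext => /=.
rewrite surviving_atE surviving_afterE /system_lifetime /order_statistic.
by rewrite -(kthE i0 (fun i => X i om) hk); exact: (lifetimeP _ hphi).
Qed.
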